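(* Let $M$ be a quasi-projective strongly harmonic left $R$-module. Then the direct sum $M^{(I)}$ of copies of $M$ is a strongly harmonic module for every index set $I$.
   Context: $R$ is an associative ring with identity; modules are unital left $R$-modules. A submodule $N\leq M$ is fully invariant if $f(N)\subseteq N$ for all $f\in\mathrm{End}_R(M)$; $\Lambda^{fi}(M)$ is the lattice of fully invariant submodules of $M$ ordered by inclusion, and $Max^{fi}(M)$ is the set of coatoms (maximal proper elements) of $\Lambda^{fi}(M)$. $M$ is quasi-projective if for every epimorphism $\rho\colon M\to X$ and every homomorphism $\alpha\colon M\to X$ there is $\beta\colon M\to M$ with $\rho\beta=\alpha$. For $N,L\leq M$ put $N_ML=\sum\{f(N)\mid f\in\mathrm{Hom}_R(M,L)\}$. A module $M$ is strongly harmonic if for every two distinct $N,L\in Max^{fi}(M)$ there exist $N',L'\in\Lambda^{fi}(M)$ with $L'\nleq L$, $N'\nleq N$ and $L'_MN'=0$. *)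

(* Defs.v *)
From HB Require Import structures.
From mathcomp Require Import all_boot all_algebra.
From mathcomp Require Import mathcomp_extra boolp classical_sets functions cardinality.

Set Implicit Arguments.
Unset Strict Implicit.
Unset Printing Implicit Defensive.

Import GRing.Theory.
Local Open Scope classical_set_scope.
Local Open Scope ring_scope.

Section Submodules.
Variables (R : pzRingType) (M : lmodType R).
Implicit Types N L K : set M.

Definition is_submodule N : Prop := submod_closed [in N].

Definition fully_invariant N : Prop :=
  is_submodule N /\ forall f : {linear M -> M}, f @` N `<=` N.

Definition max_fully_invariant N : Prop :=
  [/\ fully_invariant N, N <> setT &
      forall K, fully_invariant K -> N `<=` K -> K = N \/ K = setT].

(* The sum of a family of submodules: all finite sums of elements of members. *)
Definition submodule_sum (F : set (set M)) : set M :=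
  [set x | exists s : seq M,
     (forall y, y \in s -> exists2 A, F A & A y) /\ x = \sum_(y <- s) y].

(* N_M L.  A homomorphism M -> L is represented by an endomorphism of M whose
   image lies in L. *)
Definition submodule_prod N L : set M :=
  submodule_sum [set f @` N | f in [set f : {linear M -> M} | range f `<=` L]].

Definition strongly_harmonic : Prop :=
  forall N L, max_fully_invariant N -> max_fully_invariant L -> N <> L ->
  exists N' L', [/\ fully_invariant N', fully_invariant L',
    ~ (L' `<=` L), ~ (N' `<=` N) & submodule_prod L' N' = [set 0]].

(* Epimorphisms of modules are the surjective homomorphisms. *)
Definition quasi_projective : Prop :=
  forall (X : lmodType R) (rho alpha : {linear M -> X}), range rho = setT ->
  exists beta : {linear M -> M}, rho \o beta =1 alpha.

End Submodules.

Arguments strongly_harmonic {R} M.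
Arguments quasi_projective {R} M.

Section DirectSum.
Variables (R : pzRingType) (M : lmodType R) (I : Type).

Definition finitely_supported : {pred I -> M} :=
  fun v => `[< finite_set [set i | v i != 0] >].

Lemma finitely_supported_submod_closed : submod_closed finitely_supported.
Proof.
split=> [|a u v /asboolP fu /asboolP fv]; apply/asboolP.
  by apply: (sub_finite_set _ (finite_set0 I)) => i /=; rewrite eqxx.
have fuv : finite_set ([set i | u i != 0] `|` [set i | v i != 0]).
  by rewrite finite_setU.
apply: (sub_finite_set _ fuv) => i /= nz.
case: (eqVneq (u i) 0) => [u0|]; [right|by left].
apply: contra nz => /eqP v0.
by have -> : (a *: u + v) i = a *: u i + v i by []; rewrite u0 v0 scaler0 addr0.
Qed.

HB.instance Definition _ :=
  GRing.isSubmodClosed.Build R (I -> M) finitely_supported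
    finitely_supported_submod_closed.

(* The direct sum M^(I): families I -> M of finite support, with the pointwise
   operations inherited from I -> M. *)
Record dirsum := DirSum { dirsum_val :> I -> M; _ : dirsum_val \in finitely_supported }.

HB.instance Definition _ := [isSub for dirsum_val].
HB.instance Definition _ := [Choice of dirsum by <:].
HB.instance Definition _ := [SubChoice_isSubLmodule of dirsum by <:].

End DirectSum.

(* Main.v *)
Require Import Defs.
From mathcomp Require Import all_boot all_algebra.
From HB Require Import structures.
From mathcomp Require Import boolp classical_sets cardinality.

(** Write e_i : M -> M^(I) for the coordinate injections and p_i for the
    coordinate projections.  A fully invariant submodule K of M^(I) is stable
    under every e_j p_i, so whether e_i m lies in K does not depend on i, and
    since v is the finite sum of the e_i (v i), K consists of the families with
    all coordinates in the fully invariant submodule N = { m | e_i m in K } of M: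
    K = N^(I).  Hence, for I nonempty, N |-> N^(I) is an isomorphism between the
    lattices of fully invariant submodules of M and of M^(I)
    ([power_trace], [trace_power]), and it matches their coatoms.

    Given two distinct coatoms of M^(I), strong harmonicity of M applied to the
    corresponding coatoms of M provides N' and L' with L'_M N' = 0, and
    N'^(I), L'^(I) are the submodules sought: the matrix entries p_j f e_i of
    an endomorphism f of M^(I) with image in N'^(I) are endomorphisms of M with
    image in N', so they kill L', and f kills L'^(I).  For I empty, M^(I) = 0 has
    no coatoms. *)

Set Implicit Arguments.
Unset Strict Implicit.
Unset Printing Implicit Defensive.

Import GRing.Theory.
Local Open Scope classical_set_scope.
Local Open Scope ring_scope.

Section Submodules.
Variables (R : pzRingType) (M : lmodType R).
Implicit Types N L : set M.

Lemma is_submoduleP N :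
  is_submodule N <->
  N 0 /\ forall (a : R) (u v : M), N u -> N v -> N (a *: u + v).
Proof.
split=> [[N0 Nlin]|[N0 Nlin]]; split.
- by move: N0; rewrite inE.
- by move=> a u v /mem_set Nu /mem_set Nv; apply/set_mem/Nlin.
- by rewrite inE.
- by move=> a u v; rewrite !inE; exact: Nlin.
Qed.

Lemma submodule_bigsum N (J : Type) (s : seq J) (F : J -> M) :
  is_submodule N -> (forall j, N (F j)) -> N (\sum_(j <- s) F j).
Proof.
move=> /is_submoduleP[N0 Nlin] NF; apply: (big_ind N) => // u v Nu Nv.
by rewrite -[u]scale1r; exact: Nlin.
Qed.

Lemma submodule_prod_eq0 N L :
  (forall f : {linear M -> M}, range f `<=` L -> forall x, N x -> f x = 0) <->
  submodule_prod N L = [set 0].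
Proof.
split=> [fN0|NL0 f fL x Nx].
  rewrite eqEsubset; split=> [x [s [sP ->]]|x ->]; last first.
    by exists [::]; split=> //; rewrite big_nil.
  apply: big1_seq => y /andP[_ /sP[_ [f /= fL <-] [z Nz <-]]].
  exact: fN0.
suff : submodule_prod N L (f x) by rewrite NL0.
exists [:: f x]; split; last by rewrite big_seq1.
by move=> y; rewrite inE => /eqP ->; exists (f @` N); [exists f|exists x].
Qed.

End Submodules.

Section Coordinates.
Variables (R : pzRingType) (M : lmodType R) (I : Type).
Implicit Types (v : dirsum M I) (i j : I).

Definition proj i v : M := v i.

Lemma proj_is_linear i : linear (proj i).
Proof. by []. Qed.

HB.instance Definition _ i :=
  GRing.isLinear.Build R (dirsum M I) M _ (proj i) (proj_is_linear i).

Definition single_fun i (m : M) : I -> M := fun j => if `[< j = i >] then m else 0.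

Lemma single_fun_finite i m : single_fun i m \in @finitely_supported R M I.
Proof.
apply/asboolP/(sub_finite_set _ (finite_set1 i)) => j /=.
by rewrite /single_fun; case: asboolP; rewrite ?eqxx.
Qed.

Definition inj i (m : M) : dirsum M I := DirSum (single_fun_finite i m).

Lemma dirsumP (u v : dirsum M I) : (forall i, u i = v i) -> u = v.
Proof. by move=> uv; apply/val_inj/funext. Qed.

Lemma inj_is_linear i : linear (inj i).
Proof.
move=> a m n; apply: dirsumP => j.
rewrite -[RHS]/(a *: single_fun i m j + single_fun i n j) /= /single_fun.
by case: asboolP => // _; rewrite scaler0 addr0.
Qed.

HB.instance Definition _ i :=
  GRing.isLinear.Build R M (dirsum M I) _ (inj i) (inj_is_linear i).

Lemma proj_inj i m : proj i (inj i m) = m.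
Proof. by rewrite /proj /= /single_fun; case: asboolP. Qed.

Lemma inj_neq i j m : j <> i -> inj i m j = 0.
Proof. by rewrite /= /single_fun; case: asboolP. Qed.

Lemma dirsum_sum_inj v : exists s : seq I, v = \sum_(i <- s) inj i (proj i v).
Proof.
have /asboolP fv := valP v.
(* A duplicate-free enumeration of the support needs decidable equality on the
   index type, supplied classically. *)
have /(@finite_seqP {classic I})[s sE] := fv.
exists (undup s); apply: dirsumP => j.
rewrite -[RHS]/(proj j _) raddf_sum.
have [js|js] := boolP ((j : {classic I}) \in undup s).
  rewrite (bigD1_seq (j : {classic I}) js) ?undup_uniq // big1.
    by rewrite [LHS]/= [RHS]addr0 -[RHS]/(proj j _) proj_inj.
  by move=> i /eqP ij; apply: inj_neq => /esym.
rewrite (@big1_seq _ _ _ {classic I}) => [|i /andP[_ si]].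
  apply/eqP; apply: contraNT js => vj; rewrite mem_undup.
  by have : [set i | dirsum_val v i != 0] j by []; rewrite sE.
by apply: inj_neq => ji; move: js; rewrite ji si.
Qed.

End Coordinates.

Section PowerTrace.
Variables (R : pzRingType) (M : lmodType R) (I : Type).
Implicit Types (N : set M) (K : set (dirsum M I)) (i j : I).

(** The submodule N^(I) of M^(I). *)
Definition power N : set (dirsum M I) := [set v | forall i, N (v i)].

(** For fully invariant K the condition is the same at every index, so that
    this is the single submodule N with K = N^(I). *)
Definition trace K : set M := [set m | forall i, K (inj i m)].

Lemma power_subset N N' : N `<=` N' -> power N `<=` power N'.
Proof. by move=> NN' v Nv i; exact/NN'/Nv. Qed.

Lemma trace_subset K K' : K `<=` K' -> trace K `<=` trace K'.
Proof. by move=> KK' v Kv i; exact/KK'/Kv. Qed.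

Lemma power_setT : power setT = setT.
Proof. by apply/seteqP; split. Qed.

Lemma trace_setT : trace setT = setT.
Proof. by apply/seteqP; split. Qed.

(** The j-th coordinate of f v is the sum of the (p_j f e_i)(v i), and each
    matrix entry p_j f e_i is an endomorphism of M. *)
Lemma fully_invariant_power N : fully_invariant N -> fully_invariant (power N).
Proof.
move=> [subN fiN]; have [N0 Nlin] := (is_submoduleP N).1 subN; split.
  by apply/is_submoduleP; split=> [i|a u v Nu Nv i]; [|exact: (Nlin a _ _ (Nu i) (Nv i))].
move=> f _ [v Nv <-] j; have [s ->] := dirsum_sum_inj v.
rewrite -[dirsum_val _ _]/(proj j _) !raddf_sum.
apply: submodule_bigsum => // i.
by apply: (fiN (proj j \o (f \o inj i))); exists (proj i v) => //; exact: Nv.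
Qed.

Lemma fully_invariant_trace K : fully_invariant K -> fully_invariant (trace K).
Proof.
move=> [/is_submoduleP[K0 Klin] fiK]; split.
  apply/is_submoduleP; split=> [i|a u v Ku Kv i]; first by rewrite raddf0.
  by rewrite linearP; exact: (Klin a _ _ (Ku i) (Kv i)).
move=> g _ [m Km <-] i; apply: (fiK (inj i \o (g \o proj i))).
exists (inj i m); first exact: Km.
by rewrite -[LHS]/(inj i (g (proj i (inj i m)))) proj_inj.
Qed.

Lemma power_trace K : fully_invariant K -> power (trace K) = K.
Proof.
move=> [subK fiK]; rewrite eqEsubset; split=> [v Kv|v Kv i j].
  have [s ->] := dirsum_sum_inj v.
  by apply: submodule_bigsum => // i; exact: Kv.
by apply: (fiK (inj j \o proj i)); exists v.
Qed.

Lemma trace_power N (i0 : I) : is_submodule N -> trace (power N) = N.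
Proof.
move=> /is_submoduleP[N0 _]; rewrite eqEsubset; split=> [m Nm|m Nm i j].
  by rewrite -(proj_inj i0 m); exact: Nm.
by rewrite /= /single_fun; case: asboolP.
Qed.

Lemma fully_invariant_proper_index K :
  fully_invariant K -> K <> setT -> inhabited I.
Proof.
move=> fiK KT; apply: contrapT => I0; apply: KT.
rewrite -(power_trace fiK) eqEsubset; split=> // v _ i.
by exfalso; exact/I0/inhabits.
Qed.

Lemma max_fully_invariant_trace K :
  max_fully_invariant K -> max_fully_invariant (trace K).
Proof.
move=> [fiK KT maxK]; have [i0] := fully_invariant_proper_index fiK KT.
split; first exact: fully_invariant_trace.
  by move=> trT; apply: KT; rewrite -(power_trace fiK) trT power_setT.
move=> N fiN KN; rewrite -(trace_power i0 fiN.1).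
have [||->|->] := maxK (power N); [exact: fully_invariant_power| |by left|].
  by rewrite -{1}(power_trace fiK); exact: power_subset.
by right; exact: trace_setT.
Qed.

(** If f has image in N^(I) then its matrix entries p_j f e_i have image in N,
    so they kill L, and f v is a sum of values of matrix entries. *)
Lemma submodule_prod_power L N :
  submodule_prod L N = [set 0] -> submodule_prod (power L) (power N) = [set 0].
Proof.
move=> /submodule_prod_eq0 LN0; apply/submodule_prod_eq0 => f fN v Lv.
have [s ->] := dirsum_sum_inj v; apply: dirsumP => j.
rewrite -[LHS]/(proj j _) !raddf_sum big1 // => i _.
apply: (LN0 (proj j \o (f \o inj i))); last exact: Lv.
by move=> _ [m _ <-]; apply: fN; exists (inj i m).
Qed.

Lemma power_not_subset N K (i0 : I) :
  is_submodule N -> ~ (N `<=` trace K) -> ~ (power N `<=` K).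
Proof. by move=> subN nNK /trace_subset; rewrite (trace_power i0). Qed.

End PowerTrace.

Theorem proposition4p9 (R : pzRingType) (M : lmodType R)
    (qpM : quasi_projective M) (shM : strongly_harmonic M) (I : Type) :
  strongly_harmonic (dirsum M I).
Proof.
move=> N L maxN maxL NL; have [fiN NT _] := maxN; have [fiL _ _] := maxL.
have [i0] := fully_invariant_proper_index fiN NT.
have tNL : trace N <> trace L.
  by move=> e; apply: NL; rewrite -(power_trace fiN) e power_trace.
have [N' [L' [fiN' fiL' nL nN LN0]]] :=
  shM _ _ (max_fully_invariant_trace maxN) (max_fully_invariant_trace maxL) tNL.
exists (power N'), (power L'); split.
- exact: fully_invariant_power.
- exact: fully_invariant_power.
- exact: (power_not_subset i0 fiL'.1 nL).
- exact: (power_not_subset i0 fiN'.1 nN).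
- exact: submodule_prod_power.
Qed.
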